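(* Let $p>2$ be prime and let $1\leq k_1<\cdots<k_s$ be integers with $k_s>1$. If $r=\lfloor\log_2(k_s)\rfloor+1$, then $$\pi^*_{k_1,\ldots,k_s}(p)\equiv 0 \pmod{2^r}.$$
   Context: For integers $1\leq k_1<\cdots<k_s$ and $n\geq 1$, put $$S(\sigma_{n,[k_1,\ldots,k_s]})=\sum_{j=0}^n(-1)^{\binom{j}{k_1}+\cdots+\binom{j}{k_s}}\binom{n}{j}.$$ (For $n\ge k_s$ this is $\sum_{x\in\mathbb{F}_2^n}(-1)^{f(x)}$, where $f=\sigma_{n,k_1}+\cdots+\sigma_{n,k_s}$ is a sum of elementary symmetric polynomials over $\mathbb{F}_2$.) The integer sequence $\{S(\sigma_{n,[k_1,\ldots,k_s]})\}_{n\geq 1}$ satisfies a homogeneous linear recurrence with integer coefficients. When $k_s>1$ the sequence is not identically zero; let $x_n=a_1x_{n-1}+\cdots+a_dx_{n-d}$ be the minimal-order such recurrence with integer coefficients that it satisfies, let $\chi_{k_1,\ldots,k_s}(t)=t^d-a_1t^{d-1}-\cdots-a_d$ be its characteristic polynomial, and let $A(k_1,\ldots,k_s)$ be its $d\times d$ companion matrix. It is known that $\chi_{k_1,\ldots,k_s}(t)$ is a product of distinct factors from the list $t-2,\Phi_4(t-1),\Phi_8(t-1),\ldots,\Phi_{2^r}(t-1)$, where $r=\lfloor\log_2(k_s)\rfloor+1$ and $\Phi_m$ is the $m$-th cyclotomic polynomial, and that $\Phi_{2^r}(t-1)$ always occurs. Hence $\det A(k_1,\ldots,k_s)$ is, up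 to sign, a power of 2, and $A(k_1,\ldots,k_s)$ is invertible modulo every odd prime $p$. The weak Pisano period $\pi^*_{k_1,\ldots,k_s}(p)$ is the multiplicative order of $A(k_1,\ldots,k_s)$ modulo $p$, i.e. the least $N\ge1$ with $A(k_1,\ldots,k_s)^N\equiv I \pmod p$. *)

(* Defs.v *)
From mathcomp Require Import all_boot all_order all_algebra.

Set Implicit Arguments.
Unset Strict Implicit.
Unset Printing Implicit Defensive.

Import GRing.Theory.
Local Open Scope ring_scope.

(* S(sigma_{n,[k_1,...,k_s]}), with ks = [:: k_1; ...; k_s]. *)
Definition S_sigma (ks : seq nat) (n : nat) : int :=
  \sum_(j < n.+1) (-1) ^+ (\sum_(k <- ks) 'C(j, k))%N * 'C(n, j)%:R.

(* Sequences are indexed by n >= 1: the value x 0 is never used, since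
   size a < n and i < size a give n - i.+1 >= 1.  The coefficient a_{i+1} of
   x_{n-(i+1)} is stored as a`_i, so the order of the recurrence is size a. *)
Definition satisfies_recurrence (x : nat -> int) (a : seq int) : Prop :=
  forall n : nat, (size a < n)%N ->
    x n = \sum_(i < size a) a`_i * x (n - i.+1)%N.

Definition minimal_recurrence (x : nat -> int) (a : seq int) : Prop :=
  satisfies_recurrence x a /\
  forall b : seq int, satisfies_recurrence x b -> (size a <= size b)%N.

Definition recurrence_poly (a : seq int) : {poly int} :=
  'X^(size a) - \sum_(i < size a) a`_i *: 'X^(size a - i.+1).

Definition mx_eqmod (p d : nat) (A B : 'M[int]_d) : Prop :=
  forall i j : 'I_d, (A i j = B i j %[mod p%:Z])%Z.

Definition is_order_mod (p d : nat) (A : 'M[int]_d) (N : nat) : Prop :=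
  [/\ (1 <= N)%N,
      mx_eqmod p (A ^+ N) 1%:M
    & forall M : nat, (1 <= M)%N -> mx_eqmod p (A ^+ M) 1%:M -> (N <= M)%N].

(* N is the weak Pisano period of k_1 < ... < k_s modulo p. *)
Definition is_weak_pisano_period (ks : seq nat) (p N : nat) : Prop :=
  exists2 a : seq int, minimal_recurrence (S_sigma ks) a
    & is_order_mod p (companionmx (recurrence_poly a)) N.

(* Main.v *)
Require Import Defs.
From HB Require Import structures.
From mathcomp Require Import all_boot all_order all_algebra.
From mathcomp Require Import closed_field.
From mathcomp Require Import ring.

Set Implicit Arguments.
Unset Strict Implicit.
Unset Printing Implicit Defensive.

Import GRing.Theory.
Local Open Scope ring_scope.

(** Write [m = 2 ^ (r - 1)], so that [m <= k_s < 2 m], and let [chi] be the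
characteristic polynomial of a recurrence satisfied by [S].

Over the integers, [Psi = ('X - 1) ^+ m + 1], which is the [2 m]-th cyclotomic
polynomial at ['X - 1], divides [chi]
([shifted_cyclotomic_dvd_recurrence_poly]).  Indeed [S] is the binomial
transform of the signs [s_j = (-1) ^ ('C(j, k_1) + ... + 'C(j, k_s))], so a
recurrence for [S] says that [chi], shifted by 1, acts on [s] as a zero
difference operator (up to a factor ['X] that accounts for the indices starting
at 1).  Lucas' congruence gives [s] the period [2 m] but not the period [m], so
[u_j = s_(j + m) - s_j] is a nonzero sequence killed by ['X^m + 1].  If [Psi],
which is irreducible by Eisenstein's criterion, did not divide [chi], the two
would be coprime, and a Bezout relation would kill [u] too.

Now let [K] be an algebraic closure of the field with [p] elements and let
[z ^+ m = -1] in [K].  Then [1 + z] is a root of [chi], hence an eigenvalue of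
the companion matrix [A], and [A ^+ N = 1] modulo [p] gives
[(1 + z) ^+ N = 1] ([companion_order_root]).  Since [z^-1] is also a root of
['X^m + 1], also [(1 + z^-1) ^+ N = 1].  But [1 + z = z * (1 + z^-1)], so
[z ^+ N = 1]; as [z] has order [2 m = 2 ^ r] ([p] being odd), [2 ^ r] divides
[N].  Divisibility over the integers is what makes every [z] usable: modulo
[p] the polynomial [Psi] need not remain irreducible, and a recurrence for the
reduction of [S] could have the root [1 + z] but not [1 + z^-1]. *)

(** * Sequences as linear functionals on polynomials *)

Section Pairing.
Variable R : comNzRingType.
Implicit Types (x : nat -> R) (p q : {poly R}).

(** The umbral functional sending ['X^n] to [x n].  That [p], read as a
polynomial in the shift operator, annihilates [x] means that [pairing x]
vanishes on the ideal generated by [p]. *)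
Definition pairing x p : R := \sum_(i < size p) p`_i * x i.

Lemma pairing_widen x p n :
  (size p <= n)%N -> pairing x p = \sum_(i < n) p`_i * x i.
Proof.
move=> le_pn; rewrite /pairing (big_ord_widen n (fun i => p`_i * x i)) //.
rewrite big_mkcond; apply: eq_bigr => i _; case: ltnP => // le_pi.
by rewrite nth_default ?mul0r.
Qed.

Lemma pairing_is_scalar x : scalar (pairing x).
Proof.
move=> c p q; pose n := maxn (size p) (size q).
have le_n : (size (c *: p + q)%R <= n)%N.
  rewrite (leq_trans (size_polyD _ _)) // geq_max leq_maxr andbT.
  by rewrite (leq_trans (size_scale_leq _ _)) ?leq_maxl.
rewrite !(@pairing_widen x _ n) ?leq_maxl ?leq_maxr //= mulr_sumr -big_split /=.
by apply: eq_bigr => i _; rewrite coefD coefZ mulrDl mulrA.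
Qed.

HB.instance Definition _ x :=
  GRing.isLinear.Build R {poly R} R *%R (pairing x) (pairing_is_scalar x).

Lemma pairingXn x n : pairing x 'X^n = x n.
Proof.
rewrite /pairing size_polyXn big_ord_recr /= coefXn eqxx mul1r big1 ?add0r //.
by move=> i _; rewrite coefXn ltn_eqF ?mul0r.
Qed.

Lemma pairing_mul_eq0 x p :
  (forall n, pairing x (p * 'X^n) = 0) -> forall q, pairing x (p * q) = 0.
Proof.
move=> p0 q; rewrite -(coefK q) poly_def mulr_sumr linear_sum big1 // => i _.
by rewrite -scalerAr linearZ /= p0 mulr0.
Qed.

(** The binomial transform of a sequence is dual to the substitution of
['X + 1] for ['X], because [('X + 1) ^+ n] has the coefficients ['C(n, j)]. *)
Lemma pairing_comp_XaddC1 x p :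
  pairing x (p \Po ('X + 1)) =
    pairing (fun n => \sum_(j < n.+1) x j * 'C(n, j)%:R) p.
Proof.
rewrite comp_polyE linear_sum; apply: eq_bigr => n _.
rewrite linearZ /=; congr (_ * _).
rewrite addrC exprDn linear_sum; apply: eq_bigr => j _.
by rewrite expr1n mul1r linearMn /= pairingXn mulr_natr.
Qed.

End Pairing.

(** * The cyclotomic polynomial of order a power of 2, shifted by 1 *)

(** The Frobenius congruence, by repeated squaring. *)
Lemma exprD_pow2 (R : comNzRingType) (x y : R) e :
  exists q, (x + y) ^+ (2 ^ e) = x ^+ (2 ^ e) + y ^+ (2 ^ e) + q *+ 2.
Proof.
elim: e => [|e [q IHe]]; first by exists 0; rewrite mul0rn addr0.
rewrite expnS mulnC !exprM IHe.
set a := x ^+ _; set b := y ^+ _.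
exists (a * b + q *+ 2 * (a + b + q)); ring.
Qed.

(** For [m] a power of 2, ['X^m + 1] is the [2 m]-th cyclotomic polynomial; the
roots of this one are the [1 + z] for [z] a primitive [2 m]-th root of 1. *)
Definition shifted_cyclotomic (m : nat) : {poly int} := ('X - 1) ^+ m + 1.

Section ShiftedCyclotomic.
Variable e : nat.
Hypothesis e_gt0 : (0 < e)%N.
Local Notation m := (2 ^ e)%N.
Local Notation Psi := (shifted_cyclotomic m).

Lemma size_shifted_cyclotomic : size Psi = m.+1.
Proof.
rewrite /shifted_cyclotomic size_polyDl -polyC1 size_exp_XsubC //.
by rewrite size_polyC ltnS expn_gt0.
Qed.

Lemma shifted_cyclotomic_monic : Psi \is monic.
Proof.
rewrite monicE /shifted_cyclotomic lead_coefDl.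
  by rewrite -polyC1 (monicP _) // monic_exp // monicXsubC.
by rewrite -polyC1 size_exp_XsubC size_polyC ltnS expn_gt0.
Qed.

Lemma even_pow2 : odd m = false.
Proof. by rewrite oddX orbF -leqn0 leqNgt e_gt0. Qed.

Lemma shifted_cyclotomic_coef0 : Psi`_0 = 2.
Proof.
rewrite -horner_coef0 /shifted_cyclotomic !hornerE.
by rewrite -signr_odd even_pow2.
Qed.

(** The shift by 1 is the classical one that makes Eisenstein's criterion at 2
applicable: modulo 2 the polynomial is ['X^m], and its constant coefficient
is 2. *)
Lemma shifted_cyclotomic_irreducible : irreducible_poly Psi.
Proof.
apply: (@eisenstein_crit 2) => //.
- by rewrite size_shifted_cyclotomic eqSS -lt0n expn_gt0.
- by rewrite (monicP shifted_cyclotomic_monic).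
- by rewrite shifted_cyclotomic_coef0.
rewrite size_shifted_cyclotomic /= => i lt_im.
have [q Dq] := exprD_pow2 ('X : {poly int}) (- 1) e.
rewrite /shifted_cyclotomic Dq -signr_odd even_pow2 expr0.
have -> : 'X^m + 1 + q *+ 2 + 1 = 'X^m + (1 + q) *+ 2 :> {poly int} by ring.
rewrite coefD coefXn ltn_eqF // add0r coefMn.
by apply/dvdzP; exists (1 + q)`_i; rewrite -mulr_natr natz.
Qed.

End ShiftedCyclotomic.

(** * The sequence of signs *)

(** The case of Lucas' theorem at 2 in which a power of 2 is added to the
numerator: modulo 2 it compares coefficients in
[(1 + 'X) ^+ (j + 2 ^ e) = (1 + 'X) ^+ j * (1 + 'X^(2 ^ e))]. *)
Lemma odd_bin_addpow2 e j k :
  odd 'C(j + 2 ^ e, k) =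
    odd 'C(j, k) (+) ((2 ^ e <= k)%N && odd 'C(j, k - 2 ^ e)).
Proof.
elim: e j k => [|e IHe] j k.
  by rewrite addn1; case: k => [|k]; rewrite ?bin0 // binS oddD subn1.
rewrite expnS mul2n -addnn addnA !IHe subnDA.
have [le_ek | lt_ke] := leqP (2 ^ e) k; last first.
  rewrite (_ : (2 ^ e + 2 ^ e <= k)%N = false) ?addbF //.
  by apply/negbTE; rewrite -ltnNge ltn_addr.
rewrite -leq_subRL //=.
by do 2![case: odd] => //=; case: (_ && _).
Qed.

Definition sign_seq (ks : seq nat) (j : nat) : int :=
  (-1) ^+ (\sum_(k <- ks) 'C(j, k))%N.

Lemma odd_sum_bin_addpow2 e ks j :
  odd (\sum_(k <- ks) 'C(j + 2 ^ e, k)) =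
    odd (\sum_(k <- ks) 'C(j, k))
      (+) odd (\sum_(k <- ks | (2 ^ e <= k)%N) 'C(j, k - 2 ^ e)).
Proof.
elim: ks => [|k ks IHks]; first by rewrite !big_nil.
rewrite !big_cons; case: ifP => le_ek; rewrite !oddD IHks odd_bin_addpow2 le_ek.
  by rewrite /= addbACA.
by rewrite /= addbF addbA.
Qed.

Lemma sign_seq_periodic e ks j :
  all (fun k => k < 2 ^ e)%N ks -> sign_seq ks (j + 2 ^ e) = sign_seq ks j.
Proof.
move=> lt_ks; rewrite /sign_seq -signr_odd odd_sum_bin_addpow2.
rewrite [X in _ (+) odd X]big_seq_cond [X in _ (+) odd X]big_pred0.
  by rewrite addbF signr_odd.
move=> k; case: (boolP (k \in ks)) => //= /(allP lt_ks).
by rewrite ltnNge => /negPf->.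
Qed.

Lemma leq_last_sorted ks k :
  sorted ltn ks -> k \in ks -> (k <= last 0 ks)%N.
Proof.
move=> ks_sorted ks_k; move: ks_k ks_sorted => /splitPr[l1 l2].
rewrite last_cat /= => /cat_sorted2[_ kl2_sorted].
have /allP gt_k := order_path_min ltn_trans kl2_sorted.
by have := mem_last k l2; rewrite inE => /predU1P[-> | /gt_k/ltnW].
Qed.

(** By the congruence above, the sign changes between [j] and [j + 2 ^ e]
exactly when the sum of the ['C(j, k - 2 ^ e)] over the [k >= 2 ^ e] is odd.
For the least such [k] and [j = k - 2 ^ e], the only nonzero term of that sum is
['C(j, j) = 1]. *)
Lemma sign_seq_not_half_periodic e ks :
  sorted ltn ks -> (2 ^ e <= last 0 ks)%N ->
  exists j, sign_seq ks (j + 2 ^ e) != sign_seq ks j.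
Proof.
move=> ks_sorted le_last.
have := sorted_filter ltn_trans (leq (2 ^ e)) ks_sorted.
case Dl: (filter _ ks) => [|k l] /= kl_sorted.
  have last_in : last 0%N ks \in filter (leq (2 ^ e)) ks.
    rewrite mem_filter le_last; case: (ks) le_last => [|k0 l0] /= le0.
      by rewrite leqNgt expn_gt0 in le0.
    exact: mem_last.
  by rewrite Dl in last_in.
exists (k - 2 ^ e)%N; rewrite /sign_seq -signr_odd odd_sum_bin_addpow2.
rewrite -[X in _ != X]signr_odd -[X in _ (+) odd X]big_filter Dl big_cons binn.
rewrite [X in (_ + X)%N]big1_seq => [|k' /andP[_ l_k']]; first by case: odd.
have lt_kk' := allP (order_path_min ltn_trans kl_sorted) _ l_k'.
have le_k : (2 ^ e <= k)%N.
  by have := mem_head k l; rewrite -Dl mem_filter => /andP[].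
by rewrite bin_small // ltn_sub2r // (leq_ltn_trans le_k).
Qed.

(** * Recurrences of the exponential sums *)

Lemma recurrence_poly_tail_size (a : seq int) :
  (size (\sum_(i < size a) a`_i *: 'X^(size a - i.+1))%R <= size a)%N.
Proof.
apply: (leq_trans (size_sum _ _ _)); apply/bigmax_leqP => i _.
rewrite (leq_trans (size_scale_leq _ _)) // size_polyXn.
by rewrite -subSn // subSS leq_subr.
Qed.

Lemma recurrence_poly_monic (a : seq int) : recurrence_poly a \is monic.
Proof.
rewrite monicE lead_coefDl ?lead_coefXn // size_polyXn size_polyN ltnS.
exact: recurrence_poly_tail_size.
Qed.

(** Since a recurrence is only asserted from index 1 on, it is [chi * 'X], not
[chi], that annihilates the sequence. *)
Lemma pairing_recurrence_poly x a :
  satisfies_recurrence x a ->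
  forall n, pairing x (recurrence_poly a * 'X * 'X^n) = 0.
Proof.
move=> rec n; rewrite /recurrence_poly -mulrA -exprS mulrBl mulr_suml -exprD.
rewrite linearB linear_sum /= pairingXn rec ?addnS ?ltnS ?leq_addr //.
apply/eqP; rewrite subr_eq0; apply/eqP/eq_bigr => i _.
rewrite -scalerAl -exprD linearZ /= pairingXn; congr (_ * x _).
by rewrite -addnS -addnBAC.
Qed.

(** Otherwise [u * Psi + v * (chi * 'X) = c] with [c] a nonzero constant.  After
substitution of ['X + 1] for ['X], multiples of [Psi * ('X^m - 1)] pair to 0
with the signs by their [2 m]-periodicity, and multiples of [chi * 'X] by the
recurrence; hence [c * ('X^m - 1) * 'X^n] pairs to 0 for all [n], and the signs
would be [m]-periodic. *)
Lemma shifted_cyclotomic_dvd_recurrence_poly e ks a :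
  (0 < e)%N -> sorted ltn ks -> (2 ^ e <= last 0 ks)%N ->
  all (fun k => k < 2 ^ e.+1)%N ks ->
  satisfies_recurrence (S_sigma ks) a ->
  shifted_cyclotomic (2 ^ e) %| recurrence_poly a.
Proof.
move=> e_gt0 ks_sorted le_last lt_ks rec; apply/negPn/negP => ndvd.
set m := (2 ^ e)%N in le_last ndvd *; set Psi := shifted_cyclotomic m in ndvd.
set chi := recurrence_poly a in ndvd; set s := sign_seq ks.
have Psi_irr : irreducible_poly Psi by exact: shifted_cyclotomic_irreducible.
have co : coprimep Psi (chi * 'X).
  rewrite coprimepMr !irreducible_poly_coprime // ndvd /=.
  apply/negP => /(dvdp_leq (negbT (polyX_eq0 _))).
  rewrite size_polyX size_shifted_cyclotomic ltnS leqNgt.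
  by rewrite (leq_exp2l 1) ?e_gt0.
have [[u v] /= Duv] := Bezout_coprimepP _ _ co.
have /size_poly1P[c c_neq0 Dc] : size (u * Psi + v * (chi * 'X)) == 1%N.
  by rewrite size_poly_eq1.
have kill_Psi q : pairing s ((Psi \Po ('X + 1)) * ('X^m - 1) * q) = 0.
  apply: pairing_mul_eq0 => n.
  have -> : Psi \Po ('X + 1) = 'X^m + 1.
    rewrite rmorphD rmorphXn rmorphB /= rmorph1.
    by rewrite comp_polyX addrK.
  rewrite (_ : _ * _ * 'X^n = 'X^(n + (m + m)) - 'X^n); last first.
    by rewrite !exprD; ring.
  rewrite linearB /= !pairingXn addnn -mul2n -expnS.
  by rewrite /s sign_seq_periodic // subrr.
have kill_chi q : pairing s ((chi * 'X \Po ('X + 1)) * q) = 0.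
  have -> : q = (q \Po ('X - 1)) \Po ('X + 1).
    by rewrite -comp_polyA rmorphB /= comp_polyX rmorph1 addrK comp_polyXr.
  rewrite -rmorphM pairing_comp_XaddC1; apply: pairing_mul_eq0.
  exact: pairing_recurrence_poly.
have [n /eqP[]] := sign_seq_not_half_periodic ks_sorted le_last.
suffices : c * (s (n + m)%N - s n) = 0.
  by move/eqP; rewrite mulf_eq0 (negPf c_neq0) subr_eq0 => /eqP.
transitivity (pairing s (c *: ('X^(n + m) - 'X^n))).
  by rewrite linearZ linearB /= !pairingXn.
rewrite -mul_polyC -(comp_polyC c ('X + 1)) -Dc.
rewrite rmorphD /= !(rmorphM (comp_poly _)) /= exprD.
set P := Psi \Po _; set Q := chi \Po _; set U := u \Po _; set V := v \Po _.
rewrite (_ : _ * _ = P * ('X^m - 1) * (U * 'X^n)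
  + Q * ('X \Po ('X + 1)) * (V * ('X^n * 'X^m - 'X^n))); last by ring.
by rewrite linearD /= kill_Psi -rmorphM kill_chi addr0.
Qed.

(** * Eigenvalues of the companion matrix *)

Section CompanionEigenvector.
Variables (R K : comNzRingType) (f : {rmorphism R -> K}) (chi : {poly R}).
Variable t : K.
Hypotheses (chi_monic : chi \is monic) (chi_t : (map_poly f chi).[t] = 0).
Local Notation d := (size chi).-1.
Let v : 'cV[K]_d := \col_i t ^+ i.

(** [companionmx] has its ones above the diagonal, so it acts on the column of
powers of [t] by shifting it, the last row bringing in [chi.[t] = 0]. *)
Lemma map_companion_eigenvector :
  map_mx f (companionmx chi) *m v = t *: v.
Proof.
apply/colP=> i; rewrite !mxE.
under eq_bigr => j _ do rewrite !mxE.
have [Di | ne_i] := eqVneq (i : nat) d.-1; last first.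
  have lt_i : (i.+1 < d)%N.
    by rewrite -ltn_predRL ltn_neqAle ne_i -ltnS (ltn_predK (ltn_ord i)) /=.
  rewrite (bigD1 (Ordinal lt_i)) //= eqxx rmorph1 mul1r big1 ?addr0 ?exprS //.
  by move=> j ne_j; rewrite eq_sym [_ == _](negPf ne_j) rmorph0 mul0r.
have d_gt0 : (0 < d)%N by apply: leq_trans (ltn_ord i).
have sz : size chi = d.+1 by case: (size chi) d_gt0.
move: chi_t; rewrite (@horner_coef_wide _ d.+1); last by rewrite -sz size_poly.
rewrite big_ord_recr /= !coef_map.
have -> : chi`_d = 1 by apply/eqP.
rewrite [X in _ + X * _](rmorph1 f) mul1r -exprS Di prednK // => /eqP.
rewrite addrC addr_eq0 => /eqP->; rewrite -sumrN; apply: eq_bigr => j _.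
by rewrite coef_map rmorphN mulNr.
Qed.

Lemma map_companion_exp_eigenvector n :
  map_mx f (companionmx chi ^+ n) *m v = t ^+ n *: v.
Proof.
elim: n => [|n IHn]; first by rewrite !expr0 map_mx1 mul1mx scale1r.
rewrite exprSr -mulmxE map_mxM -mulmxA map_companion_eigenvector.
by rewrite -scalemxAr IHn scalerA exprS.
Qed.

Lemma companion_order_root n :
  (0 < d)%N -> map_mx f (companionmx chi ^+ n) = 1%:M -> t ^+ n = 1.
Proof.
move=> d_gt0 An1; have := map_companion_exp_eigenvector n.
rewrite An1 mul1mx => /colP/(_ (Ordinal d_gt0)).
by rewrite !mxE expr0 mulr1.
Qed.

End CompanionEigenvector.

(** * Divisibility of the weak Pisano period *)

(** The order of [x] divides [2 ^ e.+1], so it is a power of 2, but it does not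
divide [2 ^ e]. *)
Lemma pow2_dvd_order (K : fieldType) (x : K) e n :
  1 != -1 :> K -> x ^+ (2 ^ e) = -1 -> x ^+ n = 1 -> (2 ^ e.+1 %| n)%N.
Proof.
move=> neq1 xe xn.
have x1 : x ^+ (2 ^ e.+1) = 1 by rewrite expnS mulnC exprM xe sqrrN expr1n.
have [|o o_prim] := prim_order_exists _ x1; first by rewrite expn_gt0.
case/(dvdn_pfactor _ _ (isT : prime 2)) => f le_f Do.
move: le_f; rewrite leq_eqVlt ltnS => /orP[/eqP Df | le_f].
  by rewrite -Df -Do (prim_order_dvd o_prim) xn.
case/eqP: neq1; rewrite -xe; apply/esym/eqP.
by rewrite -(prim_order_dvd o_prim) Do dvdn_exp2l.
Qed.

Theorem theorem4p4 (p : nat) (ks : seq nat) (N : nat)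
    (p_prime : prime p) (p_gt2 : (2 < p)%N)
    (ks_sorted : sorted ltn ks) (ks_ge1 : all (leq 1) ks)
    (last_gt1 : (1 < last 0%N ks)%N) :
  let r := (trunc_log 2 (last 0%N ks)).+1 in
  is_weak_pisano_period ks p N -> (N = 0 %[mod 2 ^ r])%N.
Proof.
set e := trunc_log 2 _ => r [a [rec _] [_ AN1 _]].
have e_gt0 : (0 < e)%N by rewrite trunc_log_gt0.
have /andP[le_last lt_last] :
    (2 ^ e <= last 0 ks < 2 ^ e.+1)%N.
  by apply: trunc_log_bounds => //; exact: ltnW.
have lt_ks : all (fun k => k < 2 ^ e.+1)%N ks.
  apply/allP => k ks_k; apply: leq_ltn_trans lt_last.
  exact: leq_last_sorted.
have dvd :=
  shifted_cyclotomic_dvd_recurrence_poly e_gt0 ks_sorted le_last lt_ks rec.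
set chi := recurrence_poly a in AN1 dvd; set Psi := shifted_cyclotomic _ in dvd.
have chi_monic : chi \is monic by exact: recurrence_poly_monic.
have chi_gt0 : (0 < (size chi).-1)%N.
  have := dvdp_leq (monic_neq0 chi_monic) dvd.
  rewrite size_shifted_cyclotomic; case: (size chi) => //= d.
  by rewrite ltnS; apply: leq_trans; rewrite expn_gt0.
have [K [iota _]] := countable_algebraic_closure 'F_p.
have pK : p \in [pchar K] by rewrite (fmorph_pchar iota) pchar_Fp.
have neq1 : 1 != -1 :> K.
  by rewrite -addr_eq0 -(dvdn_pcharf pK 2) gtnNdvd.
pose f : {rmorphism int -> K} := intmul 1.
have fA : map_mx f (companionmx chi ^+ N) = 1%:M.
  apply/matrixP => i j; have /eqP := AN1 i j.
  rewrite eqz_mod_dvd => /dvdzP[q /eqP]; rewrite subr_eq => /eqP ANij.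
  rewrite mxE ANij rmorphD rmorphM /= -pmulrn (pcharf0 pK) mulr0 add0r !mxE.
  by rewrite rmorph_nat.
have root_chi (z : K) : z ^+ (2 ^ e) = -1 -> (map_poly f chi).[1 + z] = 0.
  (* As Psi is monic, pseudo-divisibility is divisibility, and it survives
     reduction modulo p. *)
  move=> z_root; have [q ->] : exists q, chi = q * Psi.
    exact/(Pdiv.IdomainMonic.dvdpP (shifted_cyclotomic_monic e)).
  rewrite /Psi /shifted_cyclotomic rmorphM rmorphD rmorphXn rmorphB /=.
  rewrite rmorph1 map_polyX !hornerE (addrC 1) addrK z_root.
  by rewrite addNr mulr0.
have expD1 (z : K) : z ^+ (2 ^ e) = -1 -> (1 + z) ^+ N = 1.
  by move=> z_root; apply: companion_order_root fA => //; exact: root_chi.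
have [z z_root] : exists z : K, z ^+ (2 ^ e) = -1.
  have [|z] := closed_rootP ('X^(2 ^ e) + 1 : {poly K}) _.
    by rewrite size_XnaddC ?expn_gt0 // eqSS -lt0n expn_gt0.
  by rewrite rootE !hornerE addr_eq0 => /eqP; exists z.
have z_neq0 : z != 0.
  apply: contra_eq_neq z_root => ->.
  by rewrite expr0n expn_eq0 /= eq_sym oppr_eq0 oner_eq0.
apply/eqP; rewrite mod0n; apply: (pow2_dvd_order neq1 z_root).
(* 1 + z and 1 + z^-1 both have N-th power 1, and their quotient is z. *)
have : (z * (1 + z^-1)) ^+ N = 1.
  by rewrite mulrDr mulr1 mulfV // addrC expD1.
by rewrite exprMn expD1 ?mulr1 // exprVn z_root invrN1.
Qed.
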